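(* Let $G=(V,E,\sigma,o)$ be a radially symmetric tree with radially symmetric weight $\sigma$. Then $$\mathrm{Mod}_{1,\sigma}(\Gamma_\infty)=\inf\{\sigma(C): C \text{ is a cut of } \Gamma_\infty\},$$ where $\sigma(C)=\sum_{e\in C}\sigma(e)$.
   Context: A weighted rooted tree $G=(V,E,\sigma,o)$ is a tree with root $o$ and edge weights $\sigma:E\to\mathbb{R}_{>0}$. The generation $\mathrm{gen}(e)$ of an edge $e$ is the number of edges of the unique path starting at $o$ and ending with $e$. An edge $e$ is the parent of $e'$ (and $e'$ a child of $e$) if they are adjacent and $\mathrm{gen}(e')=\mathrm{gen}(e)+1$; $C(e)$ is the number of children of $e$. $G$ is a proper infinite tree if it is infinite, locally finite, and every edge has at least one child. It is radially symmetric if it is a proper infinite tree and $C(e)$ depends only on $\mathrm{gen}(e)$; the weight $\sigma$ is radially symmetric if $\sigma(e)$ depends only on $\mathrm{gen}(e)$. A descending path is a path $\gamma=e_1e_2\cdots$ starting at $o$ with $e_i$ the parent of $e_{i+1}$; $\Gamma_\infty$ is the set of infinite descending paths. A cut of $\Gamma_\infty$ is a set $C\subseteq E$ with $\gamma\cap C\neq\emptyset$ for all $\gamma\in\Gamma_\infty$. A density is $\rho:E\to[0,\infty)$, $\ell_\rho(\gamma)=\sum_{e\in\gamma}\rho(e)$, $\mathrm{Adm}(\Gamma_\infty)=\{\rho\ge0:\ell_\rho(\gamma)\ge1\ \forall\gamma\in\Gamma_\infty\}$, $\mathcal{E}_{1,\sigma}(\rho)=\sum_{e\in E}\sigma(e)\rho(e)$,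 and $\mathrm{Mod}_{1,\sigma}(\Gamma_\infty)=\inf_{\rho\in\mathrm{Adm}(\Gamma_\infty)}\mathcal{E}_{1,\sigma}(\rho)$. *)

(* Defs.v *)
From HB Require Import structures.
From mathcomp Require Import all_boot all_order all_algebra.
From mathcomp Require Import finmap.
From mathcomp Require Import all_classical all_reals all_analysis.

Set Implicit Arguments.
Unset Strict Implicit.
Unset Printing Implicit Defensive.

Import Order.TTheory GRing.Theory Num.Theory.

Local Open Scope classical_set_scope.
Local Open Scope ring_scope.

Record simple_graph := SimpleGraph {
  vertex : choiceType;
  edge : choiceType;
  ends : edge -> set vertex;
  endsP : forall e, exists x y, x != y /\ ends e = [set x; y];
  ends_inj : injective ends
}.

Section Graph.
Variable G : simple_graph.
Implicit Types (x y : vertex G) (e f : edge G) (p : seq (vertex G)).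

Definition vertex_adj : rel (vertex G) :=
  fun x y => `[< exists e, ends e = [set x; y] >].

(* The path with vertices x :: p; its number of edges is [size p]. *)
Definition is_path x p := path vertex_adj x p /\ uniq (x :: p).

Definition is_tree := forall x y, exists! p, is_path x p /\ last x p = y.

Definition edge_adj e f := e != f /\ ends e `&` ends f !=set0.

(* The path from x with vertices x :: p has e as its last edge. *)
Definition path_ending_with x p e :=
  is_path x p /\
  exists q y, p = rcons q y /\ ends e = [set last x q; y].

Definition locally_finite :=
  forall x, finite_set [set e : edge G | ends e x].

End Graph.

Record weighted_rooted_tree (R : realType) := WeightedRootedTree {
  tree_graph :> simple_graph;
  tree_graphP : is_tree tree_graph;
  tree_root : vertex tree_graph;
  weight : edge tree_graph -> R;
  weight_gt0 : forall e, 0 < weight e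
}.

Section Tree.
Variables (R : realType) (G : weighted_rooted_tree R).
Implicit Types (e f : edge G) (gamma : nat -> edge G) (rho : edge G -> R).

(* In a tree exactly one path from the root ends with e, so the default value
   0 is never taken. *)
Definition gen e : nat :=
  xget 0%N [set n | exists2 p, path_ending_with (tree_root G) p e & size p = n].

Definition parent e f := edge_adj e f /\ gen f = (gen e).+1.

(* [fset_set] sends infinite sets to the empty one; sets of children are finite
   in a locally finite tree. *)
Definition nb_children e : nat := #|` fset_set [set f | parent e f]|.

Definition proper_infinite :=
  [/\ infinite_set [set: vertex G], locally_finite G &
      forall e, exists f, parent e f].

Definition radially_symmetric :=
  proper_infinite /\
  forall e f, gen e = gen f -> nb_children e = nb_children f.

Definition radially_symmetric_weight :=
  forall e f, gen e = gen f -> weight e = weight f.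

(* An infinite descending path e_1 e_2 ... is encoded by i |-> e_(i+1). *)
Definition descending_paths : set (nat -> edge G) :=
  [set gamma | ends (gamma 0%N) (tree_root G) /\
               forall i, parent (gamma i) (gamma i.+1)].

Definition is_cut (Gamma : set (nat -> edge G)) (C : set (edge G)) :=
  forall gamma, Gamma gamma -> range gamma `&` C !=set0.

Definition weight_of (C : set (edge G)) : \bar R :=
  \esum_(e in C) (weight e)%:E.

(* The edges of a descending path are distinct, so summing over indices is
   summing over edges. *)
Definition rho_length rho gamma : \bar R :=
  (\sum_(0 <= i <oo) (rho (gamma i))%:E)%E.

Definition Adm (Gamma : set (nat -> edge G)) : set (edge G -> R) :=
  [set rho | (forall e, 0 <= rho e) /\
             forall gamma, Gamma gamma -> (1 <= rho_length rho gamma)%E].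

Definition energy1 rho : \bar R :=
  \esum_(e in [set: edge G]) (weight e * rho e)%:E.

Definition Mod1 (Gamma : set (nat -> edge G)) : \bar R :=
  ereal_inf [set energy1 rho | rho in Adm Gamma].

End Tree.

Arguments descending_paths {R} G.
Arguments radially_symmetric {R} G.
Arguments radially_symmetric_weight {R} G.

(* Main.v *)
Require Import Defs.
From HB Require Import structures.
From mathcomp Require Import all_boot all_order all_algebra finmap.
From mathcomp Require Import all_classical all_reals all_analysis.

(* A cut and its indicator density have the same weight, whence "<=".
   Conversely, let N_n be the number of edges of generation n, so that the
   level of e is a cut of weight sigma(e) N_(gen e) and the infimum I over cuts
   satisfies sigma(e) >= I / N_(gen e).  Hence the energy of an admissible rho
   is at least I * T with T = sum_e rho(e) / N_(gen e), and it suffices to find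
   a descending path of rho-length at most T.  T is the mean rho-length of a
   uniformly random descending path; the path is found by the method of
   conditional expectations.  If F(e) is the part of T carried by the
   descendants of e (itself included), then N_(gen e) F(e) is the mean length
   from e on, so some child f of e satisfies
     rho(e) + N_(gen f) F(f) <= N_(gen e) F(e). *)

Set Implicit Arguments.
Unset Strict Implicit.
Unset Printing Implicit Defensive.

Import Order.TTheory GRing.Theory Num.Theory.

Local Open Scope classical_set_scope.
Local Open Scope ring_scope.

(** * Sums of nonnegative extended reals over sets *)

Section ESum.
Variables (R : realType) (T : choiceType).
Implicit Types (a : T -> \bar R) (A B : set T).
Local Open Scope ereal_scope.

Lemma esum_setU a A B : (forall i, 0 <= a i) -> A `&` B = set0 ->
  \esum_(i in A `|` B) a i = \esum_(i in A) a i + \esum_(i in B) a i.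
Proof.
move=> a0 AB; rewrite (esumID A) //.
have -> : (A `|` B) `&` A = A by apply/seteqP; split=> x /=; tauto.
suff -> : (A `|` B) `&` ~` A = B by [].
rewrite setIUl setICr set0U; apply/setIidPl => x Bx Ax.
by rewrite -[False]/(set0 x) -AB.
Qed.

Lemma esum_subset a A B : (forall i, 0 <= a i) -> A `<=` B ->
  \esum_(i in A) a i <= \esum_(i in B) a i.
Proof.
move=> a0 AB; rewrite (esumID A B) // setIC setIidl // leeDl //.
exact: esum_ge0.
Qed.

(** By induction on [s], each [D i] is split off as a set disjoint from the union of the later ones.
    In general only [<=] holds, as the [D i] need not cover [A]. *)
Lemma sum_esum_disjoint a (I : choiceType) (s : seq I) (D : I -> set T) A :
  (forall i, 0 <= a i) -> uniq s ->
  {in s &, forall i j, D i `&` D j !=set0 -> i = j} ->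
  (forall i, i \in s -> D i `<=` A) ->
  \sum_(i <- s) \esum_(x in D i) a x <= \esum_(x in A) a x.
Proof.
move=> a0 us Ds DA; pose U (r : seq I) := [set x | exists2 i, i \in r & D i x].
apply: (@le_trans _ _ (\esum_(x in U s) a x)); last first.
  by apply: esum_subset => // x [i /DA]; apply.
elim: s us Ds {DA} => [|i s IH] /= => [_ _|/andP[iNs us] Ds].
  by rewrite big_nil esum_ge0.
rewrite big_cons.
apply: (@le_trans _ _ (\esum_(x in D i) a x + \esum_(x in U s) a x)).
  rewrite leeD2l // IH // => j k js ks; apply: Ds; rewrite inE ?js ?ks orbT //.
rewrite -esum_setU //; last first.
  rewrite -subset0 => x [Dix [j js Djx]].
  by move: iNs; rewrite (Ds i j) ?js ?inE ?eqxx ?js ?orbT //; exists x.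
apply: esum_subset => // x [Dix|[j js Djx]].
  by exists i => //; rewrite mem_head.
by exists j => //; rewrite inE js orbT.
Qed.

(** The sum is a supremum over finite subsets, and [r] distributes over each finite sum. *)
Lemma muler_esum_le a A (r : R) : (0 <= r)%R -> (forall i, 0 <= a i) ->
  r%:E * (\esum_(i in A) a i) <= \esum_(i in A) (r%:E * a i).
Proof.
move=> r0 a0; rewrite -ereal_supZl //; last first.
  by apply/set0P; eexists; exists set0; [exact: fsets_set0|].
apply: ge_ereal_sup => _ [_ [F FA <-] <-].
by apply: esum_ge; exists F => //; rewrite ge0_mule_fsumr.
Qed.

(** A minimiser of [F] works. Multiplying by [size s] avoids a division in the extended reals. *)
Lemma exists_le_mean (I : choiceType) (s : seq I) (F : I -> \bar R) :
  s != [::] -> (forall i, 0 <= F i) ->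
  exists2 i, i \in s & (size s)%:R%:E * F i <= \sum_(j <- s) F j.
Proof.
case: s => [//|i0 s] _ F0.
have [i [i_s Fi]] : exists i,
    i \in i0 :: s /\ forall j, j \in i0 :: s -> F i <= F j.
  elim: s i0 => [|i1 s IH] i0.
    by exists i0; rewrite mem_head; split=> // j; rewrite inE => /eqP ->.
  have [i [i_s Fi]] := IH i1; have [le01|/ltW le10] := leP (F i0) (F i).
    exists i0; rewrite mem_head; split=> // j; rewrite inE.
    move=> /predU1P[-> //|/Fi].
    exact: le_trans.
  exists i; rewrite inE i_s orbT; split=> // j; rewrite inE.
  by move=> /predU1P[-> //|/Fi].
exists i => //; rewrite mule_natl.
elim: (i0 :: s) Fi {i_s} => [|j t IH] Fi; first by rewrite big_nil.
rewrite big_cons [size _]/= muleS leeD ?Fi ?mem_head // IH // => k kt.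
by rewrite Fi // inE kt orbT.
Qed.
End ESum.

(** * Edges of a rooted tree, coded by the paths from the root that end with them *)

Lemma setU2_eqP (T : Type) (a b c d : T) :
  [set a; b] = [set c; d] -> (a = c /\ b = d) \/ (a = d /\ b = c).
Proof.
move=> E.
have : [set c; d] a by rewrite -E; left.
have : [set c; d] b by rewrite -E; right.
have : [set a; b] c by rewrite E; left.
have : [set a; b] d by rewrite E; right.
by rewrite /=; intuition congruence.
Qed.

Section RootedTree.
Variables (G : simple_graph) (o : vertex G).
Hypothesis treeG : is_tree G.
Implicit Types (e f : edge G) (p q : seq (vertex G)).

Lemma vertex_adjP x y :
  reflect (exists e, ends e = [set x; y]) (vertex_adj x y).
Proof. exact: asboolP. Qed.

Lemma is_path_rcons p y :
  is_path o (rcons p y) <->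
  [/\ is_path o p, vertex_adj (last o p) y & y \notin o :: p].
Proof.
rewrite /is_path rcons_path -rcons_cons rcons_uniq; split.
  by move=> [/andP[-> ->] /andP[-> ->]].
by move=> [[-> ->] -> ->].
Qed.

Lemma is_path_catl p q : is_path o (p ++ q) -> is_path o p.
Proof.
by rewrite /is_path cat_path -cat_cons cat_uniq => -[/andP[-> _] /andP[-> _]].
Qed.

Lemma exists_path_to x : exists2 p, is_path o p & last o p = x.
Proof. by have [p [[]]] := treeG o x; exists p. Qed.

Lemma is_path_inj p q : is_path o p -> is_path o q -> last o p = last o q ->
  p = q.
Proof.
move=> pP qP E; have [r [_ rP]] := treeG o (last o q).
by rewrite -(rP p) ?(rP q).
Qed.

(** Two paths crossing [e] in the same direction have equal initial parts. If the directions were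
    opposite, each path would be the other one without its last step, which the lengths forbid. *)
Lemma path_ending_with_uniq p q e :
  path_ending_with o p e -> path_ending_with o q e -> p = q.
Proof.
move=> [pP [p' [x [pE ep]]]] [qP [q' [y [qE eq]]]].
move: (pP) (qP); rewrite pE qE.
move=> /is_path_rcons[p'P _ _] /is_path_rcons[q'P _ _].
have [[E ->]|[E1 E2]] := setU2_eqP (etrans (esym ep) eq).
  by rewrite (is_path_inj p'P q'P E).
have E3 : p' = q by apply: is_path_inj; rewrite // qE last_rcons.
have E4 : p = q' by apply: is_path_inj; rewrite // pE last_rcons.
have := congr1 size pE; rewrite E4 E3 qE !size_rcons => /eqP.
by rewrite ltn_eqF.
Qed.

Lemma exists_path_ending_with e : exists p, path_ending_with o p e.
Proof.
have [x [y [xy exy]]] := endsP e.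
have [p pP px] := exists_path_to x.
have adj : vertex_adj x y by apply/vertex_adjP; exists e.
have [yp|yNp] := boolP (y \in o :: p); last first.
  exists (rcons p y); split; last by exists p, y; rewrite px.
  by apply/is_path_rcons; rewrite px.
(* The path to [x] runs through [y], hence its last step is [e]. *)
exists p; split=> //.
case/splitPl: yp => p1 p2 yE in pP px *.
(* The path visits [x] only at its end, so [p1] followed by [x] is also a path; by uniqueness it is
   the whole path. *)
have xNp1 : x \notin o :: p1.
  case: p2 => [|z p2] in pP px *.
    by move: px xy; rewrite cats0 yE => ->; rewrite eqxx.
  case: pP => _; rewrite -cat_cons cat_uniq => /and3P[_ /hasPn/(_ x) + _].
  by apply; move: px; rewrite last_cat /= => <-; rewrite mem_last.
exists p1, x; split; last by rewrite yE exy setUC.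
apply: is_path_inj => //; last by rewrite last_rcons.
apply/is_path_rcons; split=> //; first exact: is_path_catl pP.
by apply/vertex_adjP; exists e; rewrite yE exy setUC.
Qed.

(** The default is never taken. With edges coded as words, generation becomes length, parenthood
    appending one vertex, and ancestry the prefix order. *)
Definition root_path e : seq (vertex G) :=
  xget [::] [set p | path_ending_with o p e].

Lemma root_pathP e : path_ending_with o (root_path e) e.
Proof.
have [p pP] := exists_path_ending_with e.
by rewrite /root_path; case: xgetP => [q -> //|/(_ p)].
Qed.

Lemma root_pathE p e : path_ending_with o p e -> root_path e = p.
Proof. exact/path_ending_with_uniq/root_pathP. Qed.

(** The last step of the path gives both ends of the edge, and a simple graph has no parallel
    edges. *)
Lemma root_path_inj : injective root_path.
Proof.
move=> e f E; have [_ [p [x [ep ee]]]] := root_pathP e.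
have [_ [q [y [fq ef]]]] := root_pathP f.
by apply: ends_inj; move: E; rewrite ep fq ee ef => /rcons_inj[-> ->].
Qed.

Lemma exists_root_path p x : is_path o (rcons p x) ->
  exists e, root_path e = rcons p x.
Proof.
move=> px; have /is_path_rcons[pP /vertex_adjP[e ee] _] := px.
by exists e; apply: root_pathE; split=> //; exists p, x.
Qed.

(** A common vertex is the near or far end of each edge. As paths to it are unique, comparing
    lengths leaves only one case: the far end of [e] is the near end of [f]. *)
Lemma root_path_child e f : ends e `&` ends f !=set0 ->
  size (root_path f) = (size (root_path e)).+1 ->
  exists y, root_path f = rcons (root_path e) y.
Proof.
have [eP [p [x [ep ee]]]] := root_pathP e.
have [fP [q [y [fq ef]]]] := root_pathP f.
rewrite ep in eP *; rewrite fq in fP *; rewrite ee ef !size_rcons.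
have [pP _ _] := (is_path_rcons _ _).1 eP.
have [qP _ _] := (is_path_rcons _ _).1 fP.
move=> [v [vE vF]] [qp].
have same r s : is_path o r -> is_path o s -> last o r = v -> last o s = v ->
  r = s by move=> rP sP rv sv; apply: is_path_inj => //; rewrite rv sv.
suff -> : q = rcons p x by exists y.
case: vE => vE; case: vF => vF.
- by move: qp; rewrite (same p q) // => /eqP; rewrite ltn_eqF.
- by move: qp; rewrite (same p (rcons q y)) ?last_rcons // size_rcons => /eqP;
    rewrite ltn_eqF.
- by apply: same; rewrite ?last_rcons.
- have : rcons p x = rcons q y by apply: same; rewrite ?last_rcons.
  by move=> /rcons_inj[pq _]; move/eqP: qp; rewrite pq ltn_eqF.
Qed.

Lemma root_path_rcons e f y : root_path f = rcons (root_path e) y ->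
  e != f /\ ends e `&` ends f !=set0.
Proof.
move=> fE; split.
  apply/eqP => ef; move: fE; rewrite ef => /(congr1 size)/eqP.
  by rewrite size_rcons ltn_eqF.
have [_ [p [x [ep ->]]]] := root_pathP e.
have [_ [q [z [fq ->]]]] := root_pathP f.
move: fE; rewrite fq ep => /rcons_inj[-> _].
by exists x; split; [right | left; rewrite last_rcons].
Qed.

(** A path never returns to its start, so [o] is the near end of [e] and nothing precedes [e]. *)
Lemma root_path_root e : ends e o -> size (root_path e) = 1%N.
Proof.
have [eP [p [x [ep ->]]]] := root_pathP e; move: eP; rewrite ep.
move=> /is_path_rcons[[_ /=/andP[oNp _]] _]; rewrite inE negb_or eq_sym.
move=> /andP[/eqP ox _] [oE|//]; case: p => [//|a p] in ep oNp oE *.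
by rewrite [X in X \notin _]oE /= mem_last in oNp.
Qed.

Lemma root_path_size1 e : size (root_path e) = 1%N -> ends e o.
Proof.
have [_ [p [x [-> ->]]]] := root_pathP e.
by rewrite size_rcons => -[/size0nil ->]; left.
Qed.

Lemma size_root_path_gt0 e : (0 < size (root_path e))%N.
Proof. by have [_ [p [x [-> _]]]] := root_pathP e; rewrite size_rcons. Qed.

Lemma exists_root_path_parent f : (1 < size (root_path f))%N ->
  exists e y, root_path f = rcons (root_path e) y.
Proof.
have [fP [q [y [fq _]]]] := root_pathP f; move: fP; rewrite fq size_rcons ltnS.
case/is_path_rcons; case/lastP: q fq => [//|q x] fq qP _ _ _.
by have [e <-] := exists_root_path qP; exists e, y.
Qed.

Lemma last_root_path_ends e y f : root_path f = rcons (root_path e) y ->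
  ends f (last o (root_path e)).
Proof.
have [_ [q [z [-> ->]]]] := root_pathP f.
by move=> /rcons_inj[-> _]; left.
Qed.

End RootedTree.

(** * Generations, descendants and finite levels *)

Section WeightedTree.
Variables (R : realType) (G : weighted_rooted_tree R).
Implicit Types (e f : edge G).

Local Notation rpath := (root_path (tree_root G)).
Local Notation treeG := (@tree_graphP R G).

Lemma genE e : gen e = size (rpath e).
Proof.
have eP := root_pathP (tree_root G) treeG e.
rewrite /gen; case: xgetP => [n _ [p pP <-]|/(_ (size (rpath e)))].
  by rewrite (path_ending_with_uniq treeG pP eP).
by case; exists (rpath e).
Qed.

Lemma gen_gt0 e : (0 < gen e)%N.
Proof. by rewrite genE size_root_path_gt0 //; exact: treeG. Qed.

Lemma gen_eq1 e : gen e = 1%N <-> ends e (tree_root G).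
Proof.
rewrite genE; split; first exact: root_path_size1 treeG _.
exact: root_path_root treeG _.
Qed.

Lemma parentP e f : parent e f <-> exists y, rpath f = rcons (rpath e) y.
Proof.
rewrite /parent !genE; split.
  by move=> [[_ adj]]; exact: (root_path_child treeG adj).
move=> [y fE]; split; last by rewrite fE size_rcons.
exact: (root_path_rcons treeG fE).
Qed.

Lemma exists_parent f : (1 < gen f)%N -> exists e, parent e f.
Proof.
rewrite genE => /(exists_root_path_parent treeG)[e [y fE]].
by exists e; apply/parentP; exists y.
Qed.

Lemma gen_parent e f : parent e f -> gen f = (gen e).+1.
Proof. by case. Qed.

Lemma gen_descending_path gamma n : descending_paths G gamma ->
  gen (gamma n) = n.+1.
Proof.
move=> [/gen_eq1 g0 gS]; elim: n => [//|n IH].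
by rewrite (gen_parent (gS n)) IH.
Qed.

Definition level n : set (edge G) := [set e | gen e = n].

Definition descendants e : set (edge G) :=
  [set f | prefix (rpath e) (rpath f)].

Lemma descendants_child e f : parent e f -> descendants f `<=` descendants e.
Proof.
move=> /parentP[y fE] g; apply: prefix_trans; rewrite fE; exact: prefix_rcons.
Qed.

Lemma descendants_self e : descendants e e.
Proof. exact: prefix_refl. Qed.

Lemma descendants_child_self e f : parent e f -> ~ descendants f e.
Proof.
by move=> /gen_parent; rewrite !genE => ef /size_prefix; rewrite ef ltnn.
Qed.

(** Both root paths are prefixes, of the same length, of the root path of a common descendant. *)
Lemma descendants_disjoint e f : gen e = gen f ->
  descendants e `&` descendants f !=set0 -> e = f.
Proof.
rewrite !genE => ef [g [eg fg]]; move: eg fg.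
rewrite /descendants /= !prefixE ef => /eqP eE /eqP fE.
exact: (root_path_inj treeG (etrans (esym eE) fE)).
Qed.

Hypothesis lfG : locally_finite G.

Lemma finite_children e : finite_set [set f | parent e f].
Proof.
apply: sub_finite_set (lfG (last (tree_root G) (rpath e))) => f /=.
by move=> /parentP[y]; exact: (last_root_path_ends treeG).
Qed.

Lemma finite_level n : finite_set (level n).
Proof.
case: n => [|n].
  rewrite (_ : level 0 = set0) // -subset0 => e /= e0.
  by have := gen_gt0 e; rewrite e0.
elim: n => [|n IH].
  by apply: sub_finite_set (lfG (tree_root G)) => e /gen_eq1.
apply: (@sub_finite_set _ _ (\bigcup_(e in level n.+1) [set f | parent e f])).
  move=> f /= fn; have [|e ef] := @exists_parent f; first by rewrite fn.
  by exists e => //=; move: (gen_parent ef); rewrite fn => -[].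
by apply: bigcup_finite => // e _; exact: finite_children.
Qed.

Definition level_size n : nat := #|` fset_set (level n)|.

Lemma level_size_gt0 e : (0 < level_size (gen e))%N.
Proof.
rewrite /level_size cardfs_gt0; apply/fset0Pn; exists e.
by rewrite in_fset_set ?inE //; exact: finite_level.
Qed.

(** Every edge of level [n.+1] is a child of one of level [n]. Level 0 is empty while level 1 holds
    the edges at the root, whence [0 < n]. *)
Lemma level_size_le n c : (0 < n)%N ->
  (forall e, gen e = n -> nb_children e = c) ->
  (level_size n.+1 <= level_size n * c)%N.
Proof.
move=> n0 nc; pose ch e : seq (edge G) := fset_set [set f | parent e f].
have /uniq_leq_size : {subset fset_set (level n.+1) <=
    flatten [seq ch e | e <- fset_set (level n)]}.
  move=> f; rewrite in_fset_set ?inE /=; last exact: finite_level.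
  move=> fn; have [|e ef] := @exists_parent f; first by rewrite fn.
  apply/flatten_mapP; exists e; rewrite in_fset_set ?inE //=.
  - by move: (gen_parent ef); rewrite fn => -[].
  - exact: finite_level.
  - exact: finite_children.
move=> /(_ (fset_uniq _))/leq_trans; apply.
rewrite size_flatten /shape -map_comp sumnE big_map.
rewrite (eq_big_seq (fun=> c)); last first.
  by move=> e /=; rewrite in_fset_set ?inE; [exact: nc|exact: finite_level].
by rewrite big_const_seq count_predT iter_addn_0 mulnC.
Qed.

(** * A descending path no longer than the mean *)

Section Greedy.
Hypothesis radG : forall e f, gen e = gen f -> nb_children e = nb_children f.
Hypothesis childG : forall e, exists f, parent e f.
Variable rho : edge G -> R.
Hypothesis rho_ge0 : forall e, 0 <= rho e.

(** [mass e] is [rho e] times the probability that the random path uses [e]; the factor in [mean]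
    conditions on passing through a given edge of generation [n]. *)
Let mass e : \bar R := (rho e / (level_size (gen e))%:R)%:E.
Let mean n (A : set (edge G)) : \bar R :=
  ((level_size n)%:R%:E * \esum_(e in A) mass e)%E.

Let mass_ge0 e : (0 <= mass e)%E.
Proof. by rewrite lee_fin divr_ge0. Qed.

Lemma exists_light_child e : exists2 f, parent e f &
  ((rho e)%:E + mean (gen f) (descendants f) <=
     mean (gen e) (descendants e))%E.
Proof.
pose ch := fset_set [set f | parent e f].
have chP f : (f \in ch) = (f \in [set f | parent e f]).
  by rewrite in_fset_set //; exact: finite_children.
have ch0 : ch != [::] :> seq _.
  have [f ef] := childG e; apply/negP => /eqP c0.
  have : f \in ch by rewrite chP inE.
  by rewrite -[f \in ch]/(f \in enum_fset ch) c0.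
pose F f := (\esum_(g in descendants f) mass g)%E.
have F0 f : (0 <= F f)%E by apply: esum_ge0.
have [f] := exists_le_mean ch0 F0; rewrite chP inE /= => ef fF.
exists f => //.
(* The descendants of [e] include [e] itself and the disjoint subtrees of its children. *)
have : (mass e + (size ch)%:R%:E * F f <= F e)%E.
  apply: (@le_trans _ _ (mass e + \sum_(j <- ch) F j)%E).
    by rewrite leeD2l.
  rewrite /F (esumID [set e] (descendants e)) //.
  apply: leeD.
    by rewrite setIC setIidl ?esum_set1 // => _ ->; exact: descendants_self.
  apply: sum_esum_disjoint => //.
    move=> i j; rewrite !chP !inE => /gen_parent ei /gen_parent ej.
    by apply: descendants_disjoint; rewrite ei ej.
  move=> i; rewrite chP inE => ei g gi; split; first exact: descendants_child gi.
  by move=> ge; apply: (descendants_child_self ei); rewrite -ge.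
move=> H; have N0 := level_size_gt0 e.
have Npos : 0 < (level_size (gen e))%:R :> R by rewrite ltr0n.
rewrite /mean -/(F e) -/(F f).
apply: le_trans (lee_wpmul2l _ H); last by rewrite lee_fin ltW.
rewrite ge0_muleDr //; last by rewrite mule_ge0 ?lee_fin.
apply: leeD; first by rewrite -EFinM mulrC divfK // gt_eqF.
rewrite muleA; apply: lee_wpmul2r => //.
(* The number of children of [e], times the size of its level, bounds the size of the next level. *)
rewrite -EFinM -natrM lee_fin ler_nat (gen_parent ef).
apply: level_size_le; first exact: gen_gt0.
by move=> e' /radG ->.
Qed.

Lemma exists_light_path : infinite_set [set: vertex G] ->
  exists2 gamma, descending_paths G gamma &
  (rho_length rho gamma <= \esum_(e in [set: edge G]) mass e)%E.
Proof.
move=> infV.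
have [next nextP] := choice (fun e => (exists2P _ _).1 (exists_light_child e)).
(* The path to any vertex other than the root starts with such an edge. *)
have [e0 e0P] : exists e, ends e (tree_root G).
  have [x xo] : exists x, x != tree_root G.
    apply: contrapT => /forallNP H; apply: infV.
    apply: (@sub_finite_set _ _ [set tree_root G]) => // x _ /=.
    by apply/eqP; have /negP := H x; rewrite negbK.
  have [[|y p] [+ _]] := exists_path_to (tree_root G) treeG x.
    by move=> _ ox; rewrite -ox eqxx in xo.
  by move=> /andP[/vertex_adjP[e ee] _] _; exists e; rewrite ee; left.
have gen0 := (gen_eq1 e0).2 e0P.
have [e1 ge1 e1T] : exists2 e1, gen e1 = 1%N &
    (mean (gen e1) (descendants e1) <= \esum_(e in [set: edge G]) mass e)%E.
  pose F f := (\esum_(g in descendants f) mass g)%E.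
  have F0 f : (0 <= F f)%E by apply: esum_ge0.
  have L1 f : (f \in fset_set (level 1)) = (f \in level 1).
    by rewrite in_fset_set //; exact: finite_level.
  have /exists_le_mean/(_ F0)[e1] : fset_set (level 1) != [::] :> seq _.
    apply/negP => /eqP c0; have : e0 \in fset_set (level 1) by rewrite L1 inE.
    by rewrite -[_ \in _]/(e0 \in enum_fset _) c0.
  rewrite L1 inE /= => ge1 H; exists e1 => //.
  rewrite /mean ge1; apply: le_trans H _.
  apply: sum_esum_disjoint => //.
  move=> i j; rewrite !L1 !inE /= => gi gj.
  by apply: descendants_disjoint; rewrite gi gj.
pose gamma n := iter n next e1.
exists gamma.
  split; first exact/gen_eq1.
  by move=> n; have [] := nextP (gamma n).
(* Invariant of the greedy choice: the length so far plus the conditional mean of the rest never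
   exceeds the total. *)
have step n : (\sum_(0 <= i < n) (rho (gamma i))%:E +
    mean (gen (gamma n)) (descendants (gamma n)) <=
    \esum_(e in [set: edge G]) mass e)%E.
  elim: n => [|n IH]; first by rewrite big_nil add0e.
  rewrite big_nat_recr //= -addeA; apply: le_trans IH.
  by rewrite leeD2l //; have [] := nextP (gamma n).
apply: lime_le; first by apply: is_cvg_nneseries => n _ _; rewrite lee_fin.
apply: nearW => n; apply: le_trans (step n); rewrite leeDl //.
by apply: mule_ge0; [rewrite lee_fin|exact: esum_ge0].
Qed.
End Greedy.
End WeightedTree.

(** * Comparison of the modulus with the infimum over cuts *)

Theorem theorem2 (R : realType) (G : weighted_rooted_tree R)
    (hG : radially_symmetric G) (hw : radially_symmetric_weight G) :
  Mod1 (descending_paths G) =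
  ereal_inf [set weight_of C | C in [set C : set (edge G) | is_cut (descending_paths G) C]].
Proof.
have [[infV lfG childG] radG] := hG.
apply/eqP; rewrite eq_le; apply/andP; split.
  apply/ereal_infP => _ [C cutC <-].
  apply: ereal_inf_lbound; exists (fun e => \1_C e).
    split=> [e|gamma /cutC[e [[n _ <-] Cn]]]; first by rewrite indicE.
    (* The partial sum up to index [n] already contains the term 1 of the edge in [C]. *)
    apply: le_trans (nneseries_lim_ge n.+1 _); last first.
      by move=> i _ _; rewrite lee_fin indicE.
    rewrite big_nat_recr //= indicE mem_set // leeDr //.
    by apply: sume_ge0 => i _; rewrite lee_fin indicE.
  rewrite /weight_of esum_mkcond; apply: eq_esum => e _.
  by rewrite indicE; case: ifP => _; rewrite ?mulr1 ?mulr0.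
set I := ereal_inf _.
have I_level (e : edge G) : (I <= (weight e * (level_size G (gen e))%:R)%:E)%E.
  have : is_cut (descending_paths G) (level (gen e)).
    (* Paths are indexed from 0 but generations start at 1. *)
    move=> gamma gammaP; exists (gamma (gen e).-1); split; first by eexists.
    by rewrite /level /= (gen_descending_path _ gammaP) prednK // gen_gt0.
  move=> cutL; apply: le_trans (ereal_inf_lbound _) _.
    by exists (level (gen e)).
  rewrite /weight_of.
  rewrite (eq_esum (b := fun=> (weight e)%:E)); last first.
    by move=> f /= fe; rewrite (hw f e fe).
  rewrite esum_fset //; first last.
  - by move=> *; rewrite lee_fin ltW // weight_gt0.
  - exact: finite_level.
  rewrite fsbig_finite //=; last exact: finite_level.
  by rewrite sumEFin big_const_seq count_predT iter_addr_0 mulr_natr.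
have I_ge0 : (0 <= I)%E.
  apply/ereal_infP => _ [C _ <-].
  by apply: esum_ge0 => e _; rewrite lee_fin ltW // weight_gt0.
apply/ereal_infP => _ [rho [rho0 rho1] <-].
have [gamma gammaP gamma_le] := exists_light_path lfG radG childG rho0 infV.
have Ifin : I \is a fin_num.
  rewrite ge0_fin_numE //; apply: le_lt_trans (I_level (gamma 0%N)) _.
  exact: ltry.
rewrite -(fineK Ifin) in I_level I_ge0 *.
pose mass (e : edge G) := (rho e / (level_size G (gen e))%:R)%:E.
apply: (@le_trans _ _ ((fine I)%:E * \esum_(e in [set: edge G]) mass e)%E).
  (* The total mass is at least the length of [gamma], hence at least 1 by admissibility. *)
  by rewrite lee_pemulr // (le_trans _ gamma_le) // rho1.
apply: le_trans (muler_esum_le _ _ _) _ => //.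
  by move=> e; rewrite lee_fin divr_ge0.
(* Edge by edge, [I_level] is multiplied by [rho e] and divided by the level size. *)
apply: le_esum => e _; rewrite -EFinM lee_fin mulrA.
have := I_level e; rewrite lee_fin => Ie.
rewrite ler_pdivrMr ?ltr0n ?level_size_gt0 // [leRHS]mulrAC.
exact: ler_wpM2r.
Qed.
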